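(* For all $(x,y)\in[0,\infty)^2$, all $(n,m)\in\mathbb N^2$ and all $t>0$, $$\mathbb E_{x,y}\,D(n,m;X_t,Y_t)=\widehat{\mathbb E}_{n,m}\,D(N_t,M_t;x,y).$$ That is, the processes $(X_t,Y_t)_{t\ge0}$ and $(N_t,M_t)_{t\ge0}$ are dual to each other with duality function $D$.
   Context: $\mathbb N=\{0,1,2,\dots\}$. Continuous process: $(X_t,Y_t)_{t\ge 0}$ is the continuous-time Markov jump process on $[0,\infty)^2$ with generator $$Lf(x,y)=\int_0^1\int_0^1\big(f(x(1-u)+yv,\;y(1-v)+xu)-f(x,y)\big)\,du\,dv,$$ i.e. at rate 1 the state $(x,y)$ is replaced by $(x(1-U)+yV,\;y(1-V)+xU)$ with $U,V$ i.i.d. uniform on $(0,1)$. $\mathbb E_{x,y}$ is expectation for the process started from $(X_0,Y_0)=(x,y)$. Discrete process: $(N_t,M_t)_{t\ge0}$ is the continuous-time Markov chain on $\mathbb N^2$ with generator $$\mathcal L f(n,m)=\sum_{k=0}^n\sum_{l=0}^m\frac{1}{(n+1)(m+1)}\big(f(n-k+l,\;m-l+k)-f(n,m)\big).$$ $\widehat{\mathbb E}_{n,m}$ is expectation for this chain started from $(N_0,M_0)=(n,m)$. Duality function: $D(n,m;x,y)=d(n,x)\,d(m,y)$ with $d(n,x)=\dfrac{x^n}{(n+1)!}$. *)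

(* Defs.v *)
From HB Require Import structures.
From mathcomp Require Import all_boot all_order all_algebra.
From mathcomp Require Import all_classical all_reals all_analysis.

Set Implicit Arguments.
Unset Strict Implicit.
Unset Printing Implicit Defensive.

Import Order.TTheory GRing.Theory Num.Theory.
Import numFieldNormedType.Exports.

Local Open Scope classical_set_scope.
Local Open Scope ring_scope.

(* Time is indexed by R, but only nonnegative times are ever constrained.
   The state space is a subset E of a measurable type S; nothing is required
   of transition probabilities started outside E. *)
Section MarkovJumpProcess.
Context {d : measure_display} {S : measurableType d} {R : realType}.
Implicit Types (E : set S) (p : R -> R.-pker S ~> S) (L : (S -> R) -> S -> R).

Definition transition_function E p : Prop :=
  [/\ forall (z : S) (A : set S), E z -> measurable A -> p 0 z A = \d_z A,
      forall (t : R) (z : S), 0 <= t -> E z -> p t z E = 1%E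
    & forall (s t : R) (z : S) (A : set S), 0 <= s -> 0 <= t -> E z ->
        measurable A -> p (s + t) z A = (\int[p s z]_w p t w A)%E].

(* The infinitesimal generator, in supremum norm over E, of the semigroup
   (P_t f)(z) = \int f dp_t(z, .) on bounded measurable functions; L is
   bounded for the processes considered here, so every such f is in the
   domain. *)
Definition has_generator E p L : Prop :=
  forall f : S -> R, measurable_fun E f -> [bounded f z | z in E] ->
    {uniform E,
      (fun (h : R) (z : S) => (Rintegral (p h z) E f - f z) / h) @ 0^'+
        --> L f}.

Context {d' : measure_display} {Omega : measurableType d'}.
Implicit Types (P : probability Omega R) (Z : R -> Omega -> S).

(* Sigma-algebra generated by Z_r, 0 <= r <= s. *)
Definition past Z (s : R) : set (set Omega) :=
  <<s \bigcup_(r in `[0, s]) preimage_set_system setT (Z r) measurable >>.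

Definition markov_property P Z p : Prop :=
  forall (s t : R) (A : set S) (B : set Omega), 0 <= s -> 0 <= t ->
    measurable A -> past Z s B ->
    P (B `&` Z (s + t) @^-1` A) = (\int[P]_(w in B) p t (Z s w) A)%E.

(* Right-continuous step function with finitely many jumps on bounded
   intervals (by compactness). *)
Definition jump_path (c : R -> S) : Prop :=
  (forall t : R, 0 <= t -> \forall s \near t^'+, c s = c t) /\
  (forall t : R, 0 < t -> exists a : S, \forall s \near t^'-, c s = a).

Definition markov_jump_process E L P Z (z : S) : Prop :=
  [/\ forall t : R, 0 <= t -> measurable_fun setT (Z t),
      forall (t : R) (w : Omega), 0 <= t -> E (Z t w),
      forall w : Omega, jump_path (Z ^~ w),
      {ae P, forall w, Z 0 w = z}
    & exists p : R -> R.-pker S ~> S,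
        [/\ transition_function E p, has_generator E p L
          & markov_property P Z p]].

End MarkovJumpProcess.

Section Models.
Context {R : realType}.

Definition quadrant : set (R * R) := [set z | 0 <= z.1 /\ 0 <= z.2].

Definition continuous_generator (f : R * R -> R) (z : R * R) : R :=
  let: (x, y) := z in
  \int[lebesgue_measure]_(v in `[0, 1])
    \int[lebesgue_measure]_(u in `[0, 1])
      (f (x * (1 - u) + y * v, y * (1 - v) + x * u) - f (x, y)).

Definition discrete_generator (f : nat * nat -> R) (z : nat * nat) : R :=
  let: (n, m) := z in
  \sum_(0 <= k < n.+1) \sum_(0 <= l < m.+1)
    (n.+1%:R * m.+1%:R)^-1 *
      (f ((n - k + l)%N, (m - l + k)%N) - f (n, m)).

Definition duality_factor (n : nat) (x : R) : R := x ^+ n / (n.+1)`!%:R.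

Definition duality_function (n m : nat) (x y : R) : R :=
  duality_factor n x * duality_factor m y.

End Models.

(* Main.v *)
(* Both x + y and n + m are conserved, so on the level x + y = s the functions
   f_i = D(i, N - i; .), 0 <= i <= N, are bounded, and with w_i = (i, N - i) the
   beta integrals give L f_i = \sum_j B i j f_j, while
   calL 1_{w_i} = \sum_j B j i 1_{w_j}.  Hence a_i(t) = E_{(x,y)} f_i and
   b_i(t) = \hat P_{(n,m)}(w_i at time t) satisfy a' = B a and b' = B^T b with
   an error uniform in t, so that \sum_i a_i(t - r) b_i(r) does not depend on r;
   its values at r = 0 and r = t are the two sides of the duality. *)

Require Import Defs.
From HB Require Import structures.
From mathcomp Require Import all_boot all_order all_algebra.
From mathcomp Require Import all_classical all_reals all_analysis.
From mathcomp Require Import measurable_realfun zify ring.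
Set Implicit Arguments.
Unset Strict Implicit.
Unset Printing Implicit Defensive.

Import Order.TTheory GRing.Theory Num.Theory.
Import numFieldNormedType.Exports.
Local Open Scope classical_set_scope.
Local Open Scope ring_scope.

(** * Pairing of linear flows with transposed matrices *)

(* The right derivative of [a] is [A a], uniformly in time. *)
Definition linear_flow {R : realType} {I : finType} (A : I -> I -> R)
    (a : R -> I -> R) : Prop :=
  forall (e : R) (i : I), 0 < e -> exists2 d : R, 0 < d &
    forall h t : R, 0 < h < d -> 0 <= t ->
      `|a (t + h) i - a t i - h * \sum_j A i j * a t j| <= h * e.

Lemma linear_flow_uniform {R : realType} {I : finType} (A : I -> I -> R)
    (a : R -> I -> R) (e : R) :
  linear_flow A a -> 0 < e -> exists2 d : R, 0 < d &
    forall (h t : R) (i : I), 0 < h < d -> 0 <= t ->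
      `|a (t + h) i - a t i - h * \sum_j A i j * a t j| <= h * e.
Proof.
move=> fa e0.
have /choice[d dP] i : exists d : R, 0 < d /\ forall h t : R, 0 < h < d ->
    0 <= t -> `|a (t + h) i - a t i - h * \sum_j A i j * a t j| <= h * e.
  by have [d d0 H] := fa e i e0; exists d.
(* [I] is finite, so the least [d i] serves every index; the cap [1] covers an empty [I]. *)
exists (\big[Num.min/1]_i d i).
  by rewrite lt_bigmin// => i _; have [] := dP i.
move=> h t i /andP[h0 hd]; apply: (dP i).2; rewrite h0/=.
exact: lt_le_trans hd (bigmin_le _ _ _).
Qed.

(* The increments of r |-> \sum_i a (t - r) i * b r i over a grid of mesh h are
   o(h): the first-order terms cancel by transposition. *)
Lemma linear_flow_pairing {R : realType} {I : finType} (A : I -> I -> R)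
    (a b : R -> I -> R) (C t : R) :
  (forall s i, 0 <= s -> `|a s i| <= C) ->
  (forall s i, 0 <= s -> `|b s i| <= C) ->
  linear_flow A a -> linear_flow (fun i j => A j i) b -> 0 <= t ->
  \sum_i a t i * b 0 i = \sum_i a 0 i * b t i.
Proof.
move=> aC bC fa fb; rewrite le_eqVlt => /predU1P[<-//|t0].
apply/eqP; rewrite -subr_eq0 -normr_le0; apply/ler_addgt0Pr => e e0.
rewrite add0r.
(* With flow error [e / (t * K)], each of the [#|I|] indices contributes two products of size at
   most [(|C| + 1) * h * e / (t * K)], at most [h * e / t] in total. The added ones keep [K]
   positive. *)
pose K := (`|C| + 1) * #|I|.+1%:R * 2.
have K0 : 0 < K by rewrite !mulr_gt0// ltr_wpDl.
have tn0 : t != 0 by rewrite gt_eqF.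
have Cn0 : `|C| + 1 != 0 by rewrite gt_eqF// ltr_wpDl.
have eK0 : 0 < e / (t * K) by rewrite divr_gt0// mulr_gt0.
have [d1 d10 {}fa] := linear_flow_uniform fa eK0.
have [d2 d20 {}fb] := linear_flow_uniform fb eK0.
have d0 : 0 < Num.min d1 d2 by rewrite lt_min d10.
have [n [h h0 [nh hd]]] : exists n : nat, exists2 h : R, 0 < h &
    n.+1%:R * h = t /\ h < Num.min d1 d2.
  (* Truncation puts [k.+1] above [t / Num.min d1 d2], so [k.+1] steps of length [t / k.+1] fill
     [[0, t]] exactly with mesh below both thresholds. *)
  pose k := Num.truncn (t / Num.min d1 d2).
  exists k, (t / k.+1%:R).
    by rewrite divr_gt0.
  split; first by rewrite mulrC divfK// pnatr_eq0.
  by rewrite ltr_pdivrMr// mulrC -ltr_pdivrMr// truncnS_gt.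
have [hd1 hd2] : 0 < h < d1 /\ 0 < h < d2.
  by move: hd; rewrite lt_min h0 => /andP[-> ->].
have step (s r : R) : 0 <= s -> 0 <= r ->
    `|\sum_i a s i * b (r + h) i - \sum_i a (s + h) i * b r i| <= h * e / t.
  move=> s0 r0.
  pose da i := a (s + h) i - a s i - h * \sum_j A i j * a s j.
  pose db i := b (r + h) i - b r i - h * \sum_j A j i * b r j.
  have -> : \sum_i a s i * b (r + h) i - \sum_i a (s + h) i * b r i =
            \sum_i (a s i * db i - da i * b r i).
    (* The names of [i] and [j] are swapped by exchanging the sums: this is where the transposed
       matrix in the flow of [b] makes the first-order terms cancel. *)
    have E : \sum_i a s i * (h * \sum_j A j i * b r j) =
             \sum_i (h * \sum_j A i j * a s j) * b r i.
      under eq_bigr do rewrite mulrCA mulr_sumr mulr_sumr.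
      under [RHS]eq_bigr do rewrite -mulrA mulr_suml mulr_sumr.
      rewrite exchange_big/=; apply: eq_bigr => i _; apply: eq_bigr => j _.
      by ring.
    rewrite -[LHS](subrK (\sum_i a s i * (h * \sum_j A j i * b r j))).
    rewrite {2}E -!sumrB -big_split/=; apply: eq_bigr => i _.
    by rewrite /da /db; ring.
  apply: le_trans (ler_norm_sum _ _ _) _.
  have bnd i : `|a s i * db i - da i * b r i| <=
      2 * (`|C| + 1) * (h * (e / (t * K))).
    apply: le_trans (ler_normB _ _) _; rewrite !normrM.
    have CC : C <= `|C| + 1 by rewrite (le_trans (ler_norm _))// lerDl.
    have h1 := ler_pM (normr_ge0 _) (normr_ge0 _)
      (le_trans (aC s i s0) CC) (fb h r i hd2 r0).
    have h2 := ler_pM (normr_ge0 _) (normr_ge0 _)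
      (fa h s i hd1 s0) (le_trans (bC r i r0) CC).
    apply: le_trans (lerD h1 h2) _.
    by rewrite le_eqVlt; apply/orP; left; apply/eqP; ring.
  apply: le_trans (ler_sum _ (fun i _ => bnd i)) _.
  rewrite sumr_const -[leLHS]mulr_natl.
  have -> : h * e / t = #|I|.+1%:R * (2 * (`|C| + 1) * (h * (e / (t * K)))).
    have : #|I|.+1%:R != 0 :> R by rewrite pnatr_eq0.
    rewrite /K; move: (#|I|.+1%:R) => N N0.
    by field; rewrite tn0 Cn0 N0.
  apply: ler_wpM2r; last by rewrite ler_nat leqW.
  by apply: mulr_ge0; [rewrite mulr_ge0// addr_ge0|exact/ltW/mulr_gt0].
(* [F k] is the pairing at [r = k * h]. Its two ends are the two sides of the goal, each step moves
   it by at most [h * e / t], and [n.+1] steps add up to [e]. *)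
pose F k := \sum_i a ((n.+1 - k)%N%:R * h) i * b (k%:R * h) i.
have FE : F 0%N = \sum_i a t i * b 0 i by rewrite /F subn0 mul0r nh.
have FE' : F n.+1 = \sum_i a 0 i * b t i by rewrite /F subnn mul0r nh.
have main k : (k <= n.+1)%N -> `|F 0%N - F k| <= k%:R * (h * e / t).
  elim: k => [|k IH] kn; first by rewrite subrr normr0 mul0r.
  rewrite -(subrK (F k) (F 0%N)) -addrA -natr1 mulrDl mul1r.
  apply: le_trans (ler_normD _ _) _; apply: lerD; first exact/IH/ltnW.
  rewrite distrC /F subSS -natr1 mulrDl mul1r.
  have -> : (n.+1 - k)%N%:R * h = (n - k)%N%:R * h + h.
    by rewrite subSn// -natr1 mulrDl mul1r.
  by apply: step; rewrite mulr_ge0// ltW.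
have := main n.+1 (leqnn _); rewrite FE FE'.
by rewrite 2!mulrA nh mulrAC divff ?mul1r.
Qed.

(** The form in which [has_generator] is used: [d] does not depend on the state, so the estimate can
    later be integrated over the state. *)
Lemma uniform_cvg_at_right {S : choiceType} {R : realType} (E : set S)
    (F : R -> S -> R) (g : S -> R) :
  {uniform E, F @ 0^'+ --> g} ->
  forall e : R, 0 < e -> exists2 d : R, 0 < d &
    forall h z, 0 < h < d -> E z -> `|F h z - g z| < e.
Proof.
move=> Fg e e0.
have : \forall h \near 0^'+, forall z, E z -> `|F h z - g z| < e.
  apply: (Fg [set f | forall z, E z -> `|f z - g z| < e]).
  apply/uniform_nbhs; exists [set xy | ball xy.1 e xy.2].
  split; first by rewrite -entourage_ballE; exists e.
  by move=> f fg z Ez; have := fg z Ez; rewrite /ball/= distrC.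
move=> [d /= d0 dF]; exists d => // h z /andP[h0 hd]; apply: dF => //=.
by rewrite sub0r normrN gtr0_norm.
Qed.

(** * Markov semigroups acting on bounded functions *)

Section markov_kernel.
Context {d : measure_display} {S : measurableType d} {R : realType}.
Implicit Types (E A : set S) (p : R -> R.-pker S ~> S) (f : S -> R).
Implicit Types (mu : {measure set S -> \bar R}) (C e s t : R) (z : S).

Lemma bounded_fun_on f C A :
  (forall z, `|f z| <= C) -> [bounded f z | z in A].
Proof.
move=> fC; exists C; split; first exact: num_real.
by move=> M CM z _ /=; exact: le_trans (fC z) (ltW CM).
Qed.

Lemma bounded_probability_integrable mu f C A :
  mu setT = 1%E -> measurable A -> measurable_fun setT f ->
  (forall z, `|f z| <= C) ->
  mu.-integrable A (EFin \o f).
Proof.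
move=> mu1 mA mf fC; apply: measurable_bounded_integrable => //.
- by rewrite (@le_lt_trans _ _ (mu setT)) ?le_measure ?inE// mu1 ltry.
- exact: measurable_funTS.
- exact: bounded_fun_on fC.
Qed.

Lemma full_measure_ae mu A :
  mu setT = 1%E -> measurable A -> mu A = 1%E -> {ae mu, forall z, A z}.
Proof.
move=> mu1 mA A1; exists (~` A); split=> //; first exact: measurableC.
by rewrite -setTD measureD//= ?setTI ?mu1 ?A1 ?subee ?ltry.
Qed.

(** Values off the full set [A] do not affect the integral, so the sharp bound [e] only has to hold
    on [A]; the cruder global bound [C] supplies integrability. *)
Lemma Rintegral_probability_bound mu f C A e :
  mu setT = 1%E -> measurable A -> mu A = 1%E -> measurable_fun setT f ->
  (forall z, `|f z| <= C) -> (forall z, A z -> `|f z| <= e) ->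
  `|\int[mu]_z f z| <= e.
Proof.
move=> mu1 mA A1 mf fC fe.
have -> : \int[mu]_z f z = \int[mu]_(z in A) f z.
  rewrite [RHS]Rintegral_mkcond /Rintegral; congr fine.
  apply: ae_eq_integral => //; first exact/measurable_EFinP.
    by apply/measurable_EFinP/(measurable_restrictT _ mA)/measurable_funTS.
  apply: filterS (full_measure_ae mu1 mA A1) => z Az _.
  by rewrite patchE mem_set.
have If := bounded_probability_integrable mu1 mA mf fC.
apply: (le_trans (le_normr_Rintegral mA If)).
have -> : e = \int[mu]_(z in A) e.
  rewrite Rintegral_cst// -[LHS]mulr1; congr *%R.
  exact: esym (congr1 fine A1).
apply: le_Rintegral => //.
  apply: (@bounded_probability_integrable mu _ C) => //.
    exact: measurableT_comp.
  by move=> z; rewrite normr_id.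
by apply: (@bounded_probability_integrable mu _ `|e|).
Qed.

Lemma Rintegral_sum (I : Type) (r : seq I) mu A (g : I -> S -> R) :
  measurable A -> (forall i, mu.-integrable A (EFin \o g i)) ->
  \int[mu]_(z in A) (\sum_(i <- r) g i z) =
  \sum_(i <- r) \int[mu]_(z in A) g i z.
Proof.
move=> mA Ig; elim: r => [|i r IHr].
  by rewrite big_nil /Rintegral; under eq_integral do rewrite big_nil;
    rewrite integral0.
rewrite big_cons -IHr -RintegralD//.
  by apply: eq_Rintegral => z _; rewrite big_cons.
rewrite (_ : EFin \o _ = fun z => (\sum_(j <- r) (g j z)%:E)%E).
  by apply: integrable_sum => // j _; exact: Ig.
by apply/funext => z /=; rewrite sumEFin.
Qed.

Lemma Rintegral_support mu f A :
  (forall z, ~ A z -> f z = 0) -> \int[mu]_(z in A) f z = \int[mu]_z f z.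
Proof.
move=> fA; rewrite Rintegral_mkcond; congr Rintegral.
apply/funext => z; rewrite patchE; case: ifPn => // /negP zA.
by rewrite fA// => Az; apply: zA; rewrite inE.
Qed.

Lemma chapman_kolmogorov_integral E p f C s t z :
  transition_function E p -> measurable_fun setT f ->
  (forall w, 0 <= f w) -> (forall w, `|f w| <= C) ->
  0 <= s -> 0 <= t -> E z ->
  \int[p (s + t) z]_w f w = \int[p s z]_w \int[p t w]_v f v.
Proof.
move=> [_ _ CK] mf f0 fC s0 t0 Ez; rewrite /Rintegral; congr fine.
(* The second kernel of [kcomp] may also depend on the initial state; [kernel_snd] makes [p t]
   ignore it. *)
pose k := kernel.kernel_snd (T0 := S) (p t).
transitivity (\int[kcomp (p s) k z]_w (f w)%:E)%E.
  by apply: eq_measure_integral => A mA _; rewrite CK.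
rewrite integral_kcomp//; last exact/measurable_EFinP.
apply: eq_integral => w _; rewrite fineK//.
apply: integrable_fin_num => //.
exact: (bounded_probability_integrable (prob_kernel _) measurableT mf fC).
Qed.

Lemma semigroup_measurable p f C t :
  measurable_fun setT f -> (forall w, 0 <= f w) -> (forall w, `|f w| <= C) ->
  measurable_fun setT (fun z => \int[p t z]_w f w) /\
  forall z, `|\int[p t z]_w f w| <= C.
Proof.
move=> mf f0 fC; split=> [|z].
  apply: (measurableT_comp (fine_measurable measurableT)).
  apply: measurable_fun_integral_kernel => //.
  - by move=> U mU; exact: measurable_kernel.
  - exact/measurable_EFinP.
by apply: (@Rintegral_probability_bound _ _ C setT) => //; exact: prob_kernel.
Qed.

(** By Chapman-Kolmogorov, the increment from [t] to [t + h] is the integral under [p t z] of the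
    increment from [0] to [h]. The latter is [h * L (g i)] up to [h * e] uniformly on [E], which has
    mass 1 under [p t z]; hence the error is uniform in [t]. *)
Lemma semigroup_linear_flow (I : finType) E p (L : (S -> R) -> S -> R)
    (B : I -> I -> R) (g : I -> S -> R) C z :
  measurable E -> transition_function E p -> has_generator E p L ->
  (forall i, measurable_fun setT (g i)) -> (forall i w, 0 <= g i w) ->
  (forall i w, `|g i w| <= C) -> (forall i w, ~ E w -> g i w = 0) ->
  (forall i w, E w -> L (g i) w = \sum_j B i j * g j w) -> E z ->
  linear_flow B (fun t i => \int[p t z]_w g i w).
Proof.
move=> mE tp gp mg g0 gC gE Lg Ez e i e0.
have [d1 d10 dP] := uniform_cvg_at_right
  (gp (g i) (measurable_funTS (mg i)) (bounded_fun_on E (gC i))) e0.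
exists d1 => // h t hd t0; have /andP[h0 _] := hd.
have [mG GC] := semigroup_measurable p h (mg i) (g0 i) (gC i).
have pE1 : p t z E = 1%E by case: tp => _ -> .
have pT1 : p t z setT = 1%E by exact: prob_kernel.
have Int f C' (mf : measurable_fun setT f) (fC : forall w, `|f w| <= C') :
    (p t z).-integrable setT (EFin \o f).
  exact: bounded_probability_integrable mf fC.
have IntB j : (p t z).-integrable setT (EFin \o (fun w => B i j * g j w)).
  apply: (Int _ (`|B i j| * C)) => [|w]; first exact: measurable_funM.
  by rewrite normrM ler_wpM2l.
have mBg : measurable_fun setT (fun w => \sum_j B i j * g j w).
  by apply: measurable_sum => j; exact: measurable_funM.
have BgC w : `|\sum_j B i j * g j w| <= \sum_j `|B i j| * C.
  apply: le_trans (ler_norm_sum _ _ _) _; apply: ler_sum => j _.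
  by rewrite normrM ler_wpM2l.
pose phi w := \int[p h w]_v g i v - g i w - h * \sum_j B i j * g j w.
have -> : \int[p (t + h) z]_w g i w - \int[p t z]_w g i w -
    h * \sum_j B i j * \int[p t z]_w g j w = \int[p t z]_w phi w.
  rewrite (chapman_kolmogorov_integral tp (mg i) (g0 i) (gC i)) ?(ltW h0)//.
  rewrite /phi RintegralB//; last 2 first.
  - apply: (Int _ (C + C)) => [|w]; first exact: measurable_funB.
    by rewrite (le_trans (ler_normB _ _))// lerD.
  - apply: (Int _ (h * \sum_j `|B i j| * C)) => [|w]; first exact: measurable_funM.
    by rewrite normrM gtr0_norm// ler_pM2l.
  rewrite RintegralB//; [|exact: Int mG GC|exact: Int (mg i) (gC i)].
  rewrite RintegralZl//; last exact: Int mBg BgC.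
  rewrite Rintegral_sum//; congr (_ - _ * _); apply: eq_bigr => j _.
  by rewrite RintegralZl//; exact: Int (mg j) (gC j).
apply: (@Rintegral_probability_bound _ _ (C + C + h * \sum_j `|B i j| * C) E) => //.
- by apply: measurable_funB; [exact: measurable_funB|exact: measurable_funM].
- move=> w; rewrite (le_trans (ler_normB _ _))// lerD//.
    by rewrite (le_trans (ler_normB _ _))// lerD.
  by rewrite normrM gtr0_norm// ler_pM2l.
- move=> w Ew; have := dP h w hd Ew.
  (* [has_generator] integrates over [E] only; as [g i] vanishes off [E], this is the integral over
     the whole space. *)
  rewrite Rintegral_support; last exact: gE.
  rewrite Lg// => /ltW H.
  have -> : phi w = h * ((\int[p h w]_v g i v - g i w) / h - \sum_j B i j * g j w).
    by rewrite mulrBr mulrCA divff ?mulr1// gt_eqF.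
  by rewrite normrM gtr0_norm// ler_pM2l.
Qed.

Lemma transition_function0 E p f z :
  transition_function E p -> measurable_fun setT f -> E z ->
  \int[p 0 z]_w f w = f z.
Proof.
move=> [p0 _ _] mf Ez; rewrite /Rintegral.
rewrite (@eq_measure_integral _ _ _ _ \d_z); last by move=> A mA _; exact: p0.
by rewrite integral_dirac ?diracT ?mul1e//; exact/measurable_EFinP.
Qed.

(** The mass of [A] is a flow of the 1 by 1 zero matrix. Pairing it with the constant flow 1 shows
    that it keeps its value at time 0, which is 1. *)
Lemma transition_function_invariant E p (L : (S -> R) -> S -> R) A t z :
  measurable E -> measurable A -> A `<=` E ->
  transition_function E p -> has_generator E p L ->
  (forall w, E w -> L \1_A w = 0) -> A z -> 0 <= t -> p t z A = 1%E.
Proof.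
move=> mE mA AE tp gp LA Az t0; have Ez := AE _ Az.
have fa : linear_flow (fun _ _ : unit => 0 : R) (fun t _ => \int[p t z]_w \1_A w).
  apply: (@semigroup_linear_flow unit E p L _ (fun=> \1_A) 1) => //.
  - by move=> _ w; rewrite indicE; case: (_ \in _); rewrite ?normr1 ?normr0.
  - by move=> _ w nEw; rewrite indicE memNset// => /AE.
  - by move=> _ w Ew; rewrite LA// big1// => j _; rewrite mul0r.
have fb : linear_flow (fun _ _ : unit => 0 : R) (fun _ _ => 1).
  move=> e _ e0; exists 1 => // h s /andP[h0 _] _.
  by rewrite subrr big1 ?mulr0 ?subrr ?normr0 ?mulr_ge0 ?ltW// => j _; rewrite mul0r.
have I1 w : `|\1_A w : R| <= 1.
  by rewrite indicE; case: (_ \in _); rewrite ?normr1 ?normr0.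
have aC s (i : unit) : 0 <= s -> `|\int[p s z]_w \1_A w| <= 1.
  move=> _; apply: (semigroup_measurable p s _ _ I1).2 => //.
have bC s (i : unit) : 0 <= s -> `|1 : R| <= 1 by rewrite normr1.
have := linear_flow_pairing aC bC fa fb t0.
under eq_bigr do rewrite mulr1.
under [RHS]eq_bigr do rewrite mulr1.
rewrite !sumr_const card_unit !mulr1n (transition_function0 tp)//.
rewrite indicE mem_set// /Rintegral integral_indic// setIT => H.
rewrite -[LHS]fineK; last exact: finite_kernel_measure.
by congr EFin; exact: H.
Qed.

End markov_kernel.

(** * The law of the process at a fixed time *)

Section markov_process.
Context {d : measure_display} {S : measurableType d} {R : realType}.
Context {d' : measure_display} {Omega : measurableType d'}.
Implicit Types (p : R -> R.-pker S ~> S).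
Implicit Types (P : probability Omega R) (Z : R -> Omega -> S).

(** This is the Markov property from time 0 on the event [setT], where [Z 0] is almost surely
    [z]. *)
Lemma markov_marginal P Z p t z (A : set S) :
  measurable_fun setT (Z 0) -> {ae P, forall w, Z 0 w = z} ->
  markov_property P Z p -> 0 <= t -> measurable A ->
  P (Z t @^-1` A) = p t z A.
Proof.
move=> mZ Z0 Zp t0 mA.
have pT : past Z 0 setT.
  have := sigma_algebraC (@sigma_algebra0 _ setT
    (\bigcup_(r in `[0, 0]) preimage_set_system setT (Z r) measurable)).
  by rewrite setC0.
have := Zp 0 t A setT (lexx 0) t0 mA pT; rewrite setTI add0r => ->.
transitivity (\int[P]_w p t z A)%E.
  apply: ae_eq_integral => //.
    exact: (measurableT_comp (measurable_kernel (p t) A mA) mZ).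
  by apply: filterS Z0 => w -> _.
rewrite integral_cst// -[RHS]mule1; congr (_ * _)%E; exact: probability_setT.
Qed.

(** [F] may be unbounded, but almost surely only its values on [V] are seen. There it is bounded, so
    the extended-real expectation is a finite integral against the law. *)
Lemma expectation_on_full_set P Z p t z (V : set S) (F : S -> R) C :
  measurable_fun setT (Z t) ->
  (forall A, measurable A -> P (Z t @^-1` A) = p t z A) ->
  measurable V -> p t z V = 1%E ->
  measurable_fun setT F -> (forall w, `|(F \_ V) w| <= C) ->
  'E_P[fun w => F (Z t w)]%E = (\int[p t z]_v (F \_ V) v)%:E.
Proof.
move=> mZ law mV V1 mF FC.
have mFV : measurable_fun setT (F \_ V).
  by apply/(measurable_restrictT _ mV)/measurable_funTS.
have IFV := bounded_probability_integrable (prob_kernel z) measurableT mFV FC.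
rewrite unlock /Rintegral fineK; last exact: integrable_fin_num.
transitivity (\int[P]_w ((F \_ V) (Z t w))%:E)%E.
  apply: ae_eq_integral => //.
  - exact/measurable_EFinP/(measurableT_comp mF mZ).
  - exact/measurable_EFinP/(measurableT_comp mFV mZ).
  have ZV : P (Z t @^-1` V) = 1%E by rewrite law.
  have mZV : measurable (Z t @^-1` V).
    by rewrite -[X in measurable X]setTI; exact: mZ.
  apply: filterS (full_measure_ae (probability_setT P) mZV ZV) => w Vw _.
  by rewrite patchE mem_set.
rewrite -[RHS](_ : \int[pushforward P (Z t)]_v ((F \_ V) v)%:E = _)%E; last first.
  by apply: eq_measure_integral => A mA _; rewrite -law.
rewrite (integral_pushforward mZ)//; first exact/measurable_EFinP.
by apply: (bounded_probability_integrable (probability_setT P) measurableT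
  (measurableT_comp mFV mZ)) => w; exact: FC.
Qed.

End markov_process.

(** * Euler's beta integrals on the unit interval *)

Section beta_integrals.
Context {R : realType}.
Notation mu := (@lebesgue_measure R).

Lemma Rintegral_XMonemX (a b : nat) :
  \int[mu]_(u in `[0, 1]) XMonemX a b u = (a`! * b`!)%:R / (a + b).+1`!%:R.
Proof. by rewrite -beta_fun_fact /beta_fun -Rintegral_mkcond. Qed.

(** Shaped after the integrand of [continuous_generator]: an expanded value after the jump minus the
    constant value [r] before it. *)
Lemma Rintegral_sum_XMonemX (I : finType) (c : I -> R) (a b : I -> nat) (r : R) :
  \int[mu]_(u in `[0, 1]) (\sum_i c i * XMonemX (a i) (b i) u - r) =
  \sum_i c i * ((a i)`! * (b i)`!)%:R / (a i + b i).+1`!%:R - r.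
Proof.
have Ic i : mu.-integrable `[0, 1] (EFin \o (fun u => c i * XMonemX (a i) (b i) u)).
  have H := integrable_XMonemX (R := R) (a i) (b i).
  by apply: integrableZl H => //.
rewrite RintegralB//; last 2 first.
- rewrite (_ : EFin \o _ = fun u => (\sum_i (c i * XMonemX (a i) (b i) u)%:E)%E).
    by apply: integrable_sum => // i _; exact: Ic.
  by apply/funext => u /=; rewrite sumEFin.
- apply: (@measurable_bounded_integrable _ _ _ mu (cst r)) => //.
    by rewrite /= lebesgue_measure_itv/= lte01 EFinN sube0 ltry.
  exact: (@bounded_fun_on _ _ _ _ `|r|).
rewrite Rintegral_cst//= lebesgue_measure_itv/= lte01 EFinN sube0 mulr1.
congr (_ - _); rewrite Rintegral_sum//; apply: eq_bigr => i _.
rewrite RintegralZl//; last exact: integrable_XMonemX.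
by rewrite Rintegral_XMonemX mulrA.
Qed.

End beta_integrals.

(** * Duality of the two generators *)

Section generators.
Context {R : realType}.

(** The binomial theorem gives terms in [v^k (1-v)^(m-l) u^l (1-u)^(n-k)]. Their beta integrals
    supply the factorials of [D(n-k+l, m-l+k)], and [C(n,k) k! (n-k)! / (n+1)! = 1/(n+1)], with its
    analogue for [m], leaves the discrete jump rate. *)
Lemma continuous_discrete_generator (n m : nat) (x y : R) :
  continuous_generator (fun z => duality_function n m z.1 z.2) (x, y) =
  discrete_generator (fun w => duality_function w.1 w.2 x y) (n, m).
Proof.
pose c (i : 'I_n.+1 * 'I_m.+1) : R :=
  x ^+ (n - i.1) * y ^+ i.1 * 'C(n, i.1)%:R *
  (y ^+ (m - i.2) * x ^+ i.2 * 'C(m, i.2)%:R) /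
  (n.+1`!%:R * m.+1`!%:R).
have expand (u v : R) :
    duality_function n m (x * (1 - u) + y * v) (y * (1 - v) + x * u) =
    \sum_i c i * XMonemX i.1 (m - i.2) v * XMonemX i.2 (n - i.1) u.
  rewrite /duality_function /duality_factor !exprDn mulrACA -invfM.
  rewrite big_distrlr/= pair_bigA/= mulr_suml; apply: eq_bigr => -[k l] _ /=.
  rewrite /c /XMonemX /unstable.onem /= -[_ *+ 'C(n, k)]mulr_natr.
  rewrite -[_ *+ 'C(m, l)]mulr_natr !exprMn.
  move: (_^-1) => F; ring.
rewrite /continuous_generator/=.
(* The integral in [u] comes first, with the factors in [v] as coefficients; regrouping then
   restores the shape needed to integrate in [v]. *)
under eq_Rintegral => v _.
  under eq_Rintegral do rewrite expand.
  rewrite Rintegral_sum_XMonemX.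
  under eq_bigr do rewrite -mulrA mulrAC.
  over.
rewrite Rintegral_sum_XMonemX /discrete_generator.
rewrite !big_mkord.
under [RHS]eq_bigr do rewrite big_mkord.
rewrite pair_bigA/=.
under [RHS]eq_bigr do rewrite mulrBr.
(* The [(n+1)(m+1)] copies of [D(n, m)], each weighted by the jump rate, add up to the subtracted
   constant. *)
rewrite sumrB; congr (_ - _); last first.
  rewrite sumr_const card_prod !card_ord -[RHS]mulr_natl natrM mulVKf//.
apply: eq_bigr => -[k l] _ /=; have [kn lm] := (ltn_ord k, ltn_ord l).
rewrite ltnS in kn lm.
have En : n.+1`!%:R = n.+1%:R * ('C(n, k)%:R * (k`!%:R * (n - k)`!%:R)) :> R.
  by rewrite -!natrM bin_fact// factS.
have Em : m.+1`!%:R = m.+1%:R * ('C(m, l)%:R * (l`!%:R * (m - l)`!%:R)) :> R.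
  by rewrite -!natrM bin_fact// factS.
have nz (q : nat) : (0 < q)%N -> q%:R != 0 :> R by rewrite pnatr_eq0 -lt0n.
have Fn := nz _ (fact_gt0 k); have Fnk := nz _ (fact_gt0 (n - k)).
have Fl := nz _ (fact_gt0 l); have Fml := nz _ (fact_gt0 (m - l)).
have Bn : 'C(n, k)%:R != 0 :> R by apply: nz; rewrite bin_gt0.
have Bm : 'C(m, l)%:R != 0 :> R by apply: nz; rewrite bin_gt0.
have Sn := nz n.+1 isT; have Sm := nz m.+1 isT.
have F1 := nz _ (fact_gt0 (l + (n - k)).+1).
have F2 := nz _ (fact_gt0 (k + (m - l)).+1).
rewrite /duality_function /duality_factor /c /= En Em.
rewrite (addnC (n - k)%N) (addnC (m - l)%N) !exprD.
(* Factorials and binomials become variables, so that only a rational identity is left to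
   [field]. *)
move: ((l + (n - k)).+1`!%:R) ((k + (m - l)).+1`!%:R) F1 F2 => b1 b2 F1 F2.
rewrite !natrM.
move: (n.+1%:R) (m.+1%:R) ('C(n, k)%:R) ('C(m, l)%:R) (k`!%:R) (l`!%:R)
  ((n - k)`!%:R) ((m - l)`!%:R) Fn Fnk Fl Fml Bn Bm Sn Sm.
move=> a1 a2 a3 a4 a5 a6 a7 a8 *; field.
by do ![apply/andP; split].
Qed.

End generators.

(** * Levels of the conserved quantities *)

Section level_sets.
Context {R : realType}.

Definition quadrant_level (s : R) : set (R * R) :=
  [set z | quadrant z /\ z.1 + z.2 = s].

Definition nat_level (N : nat) : set (nat * nat) := [set w | (w.1 + w.2 = N)%N].

(** Indexing the level by its first coordinate provides the finite index type of the linear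
    flows. *)
Definition nat_level_state (N : nat) (i : 'I_N.+1) : nat * nat :=
  (val i, (N - i)%N).

Lemma nat_level_stateP N (i : 'I_N.+1) : nat_level N (nat_level_state i).
Proof. by rewrite /nat_level/= subnKC// -ltnS. Qed.

Lemma sum_nat_level_state N (g : nat * nat -> R) (w : nat * nat) :
  \sum_(i < N.+1) \1_[set nat_level_state i] w * g (nat_level_state i) =
  (g \_ (nat_level N)) w.
Proof.
rewrite patchE; case: ifPn => [|/negP]; rewrite inE => wN; last first.
  rewrite big1// => i _; rewrite indicE memNset ?mul0r// => /= wE.
  by apply: wN; rewrite wE; exact: nat_level_stateP.
have w1 : (w.1 < N.+1)%N by rewrite ltnS -wN leq_addr.
have wE : w = nat_level_state (Ordinal w1).
  by rewrite /nat_level_state/= -wN addKn; case: (w).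
rewrite (bigD1 (Ordinal w1))//= -wE indicE mem_set// mul1r big1 ?addr0//.
move=> i /eqP iw; rewrite indicE memNset ?mul0r// => wi.
by apply: iw; apply: val_inj; rewrite /= wi.
Qed.

Lemma measurable_nat_pair (A : set (nat * nat)) : measurable A.
Proof.
apply: countable_measurable; last exact: countableP.
move=> [a b].
have -> : [set (a, b)] = [set a] `*` [set b].
  by apply/seteqP; split=> [[? ?] [-> ->]|[? ?] /= [-> ->]].
exact: measurableX.
Qed.

Lemma measurable_quadrant : measurable (@quadrant R).
Proof.
have -> : @quadrant R = (fst @^-1` `[0, +oo[) `&` (snd @^-1` `[0, +oo[).
  by apply/seteqP; split=> z /=; rewrite !in_itv/= !andbT.
by apply: measurableI; rewrite -[X in measurable X]setTI;
  [apply: measurable_fst|apply: measurable_snd].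
Qed.

Lemma measurable_quadrant_level s : measurable (quadrant_level s).
Proof.
have -> : quadrant_level s = @quadrant R `&` ((fst \+ snd) @^-1` [set s]) by [].
apply: measurableI; first exact: measurable_quadrant.
rewrite -[X in measurable X]setTI.
by apply: (measurable_funD measurable_fst measurable_snd).
Qed.

Lemma measurable_duality_function n m :
  measurable_fun setT (fun z : R * R => duality_function n m z.1 z.2).
Proof.
by apply: measurable_funM; apply: measurable_funM => //; apply: measurable_funX;
  [exact: measurable_fst|exact: measurable_snd].
Qed.

Lemma duality_function_ge0 n m (x y : R) :
  0 <= x -> 0 <= y -> 0 <= duality_function n m x y.
Proof. by move=> x0 y0; rewrite !mulr_ge0 ?invr_ge0 ?exprn_ge0. Qed.

(** On the level each coordinate is at most [s], and the factorials in the denominators are at least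
    1. *)
Lemma duality_function_level_le n m s z : quadrant_level s z ->
  duality_function n m z.1 z.2 <= s ^+ (n + m).
Proof.
move=> [[z1 z2] zs].
have factor_le k (u : R) : 0 <= u -> u <= s -> duality_factor k u <= s ^+ k.
  move=> u0 us; rewrite /duality_factor.
  apply: (@le_trans _ _ (u ^+ k)).
    rewrite ler_pdivrMr ?ltr0n ?fact_gt0// ler_peMr ?exprn_ge0//.
    by rewrite ler1n fact_gt0.
  by rewrite lerXn2r// nnegrE (le_trans u0).
rewrite exprD /duality_function ler_pM ?factor_le//.
- by rewrite mulr_ge0 ?invr_ge0 ?exprn_ge0.
- by rewrite mulr_ge0 ?invr_ge0 ?exprn_ge0.
- by rewrite -zs lerDl.
- by rewrite -zs lerDr.
Qed.

(** For [u] and [v] in [[0, 1]] a jump stays in the quadrant and conserves [x + y], so the points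
    before and after it lie on the level together or not at all. *)
Lemma continuous_generator_level s (f : R * R -> R) z : quadrant z ->
  continuous_generator (f \_ (quadrant_level s)) z =
  if z \in quadrant_level s then continuous_generator f z else 0.
Proof.
case: z => x y [/= x0 y0]; rewrite /continuous_generator.
have jump (u v : R) : u \in (`[0, 1]%classic : set R) ->
    v \in (`[0, 1]%classic : set R) ->
    ((x * (1 - u) + y * v, y * (1 - v) + x * u) \in quadrant_level s) =
    ((x, y) \in quadrant_level s).
  rewrite !inE /= !in_itv/= => /andP[u0 u1] /andP[v0 v1]; apply/idP/idP.
    by rewrite !inE => -[_ /= <-]; split=> //=; ring.
  rewrite !inE => -[_ /= <-]; split=> /=; last by ring.
  by split=> /=; rewrite addr_ge0 ?mulr_ge0 ?subr_ge0.
case: ifPn => zs.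
  apply: eq_Rintegral => v v01; apply: eq_Rintegral => u u01.
  by rewrite !patchE jump// zs.
have int0 (g : R -> R) :
    (forall v, v \in (`[0, 1]%classic : set R) -> g v = 0) ->
    \int[lebesgue_measure]_(v in `[0, 1]) g v = 0.
  by move=> g0; rewrite /Rintegral integral0_eq// => v v01; rewrite g0// inE.
apply: (int0) => v v01; apply: (int0) => u u01.
by rewrite !patchE jump// (negbTE zs) subrr.
Qed.

(** The ranges of [k] and [l] make the truncated subtractions exact, so every jump conserves
    [n + m]. *)
Lemma discrete_generator_level N (g : nat * nat -> R) w :
  discrete_generator (g \_ (nat_level N)) w =
  if w \in nat_level N then discrete_generator g w else 0.
Proof.
case: w => n m; rewrite /discrete_generator !big_mkord.
have jump k l : (k <= n)%N -> (l <= m)%N ->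
    ((n - k + l, m - l + k)%N \in nat_level N) = ((n, m) \in nat_level N).
  by move=> kn lm; apply/idP/idP; rewrite !inE /nat_level/= => <-; lia.
case: ifPn => wN.
  apply: eq_bigr => k _; apply: eq_big_nat => l /andP[_ lm].
  by rewrite !patchE jump ?wN// -ltnS.
rewrite big1// => k _; rewrite big_nat big1// => l /andP[_ lm].
by rewrite !patchE jump ?(negbTE wN) ?subrr ?mulr0// -ltnS.
Qed.

Lemma discrete_generator_sum (I : Type) (r : seq I) (c : I -> R)
    (g : I -> nat * nat -> R) w :
  discrete_generator (fun w => \sum_(i <- r) g i w * c i) w =
  \sum_(i <- r) discrete_generator (g i) w * c i.
Proof.
case: w => n m; rewrite /discrete_generator.
under [RHS]eq_bigr do rewrite mulr_suml.
rewrite [RHS]exchange_big/=; apply: eq_bigr => k _.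
under [RHS]eq_bigr do rewrite mulr_suml.
rewrite [RHS]exchange_big/=; apply: eq_bigr => l _.
rewrite -sumrB mulr_sumr; apply: eq_bigr => i _.
by rewrite -mulrBl mulrA.
Qed.

End level_sets.

(** * Closed linear systems and invariance on a level *)

Section duality.
Context {R : realType}.

(** Generator duality moves the action to the discrete variable. There [D(., z)] cut off to level
    [N] is a combination of indicators of its states, and linearity finishes. *)
Lemma duality_generator_rates (N : nat) (s : R) (i : 'I_N.+1) z : quadrant z ->
  continuous_generator
    ((fun z => duality_function i (N - i) z.1 z.2) \_ (quadrant_level s)) z =
  \sum_(j < N.+1)
    discrete_generator \1_[set nat_level_state j] (nat_level_state i) *
    ((fun z => duality_function j (N - j) z.1 z.2) \_ (quadrant_level s)) z.
Proof.
move=> qz; rewrite continuous_generator_level//; case: ifPn => zs; last first.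
  by rewrite big1// => j _; rewrite patchE (negbTE zs) mulr0.
under eq_bigr do rewrite patchE zs.
rewrite [z]surjective_pairing continuous_discrete_generator.
rewrite -(discrete_generator_sum _
  (fun j : 'I_N.+1 => duality_function j (N - j) z.1 z.2)
  (fun j => \1_[set nat_level_state j])).
have -> : (fun w => \sum_(j < N.+1) \1_[set nat_level_state j] w *
    duality_function j (N - j) z.1 z.2) =
    (fun w => duality_function w.1 w.2 z.1 z.2) \_ (nat_level N).
  apply/funext => w.
  exact: (sum_nat_level_state N (fun w => duality_function w.1 w.2 z.1 z.2)).
by rewrite discrete_generator_level mem_set//; exact: nat_level_stateP.
Qed.

(** The image of the indicator vanishes off level [N], so it is the sum of its values there times
    indicators. The rates are those of [duality_generator_rates], transposed. *)
Lemma indicator_generator_rates (N : nat) (i : 'I_N.+1) (w : nat * nat) :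
  discrete_generator (\1_[set nat_level_state i] : _ -> R) w =
  \sum_(j < N.+1)
    discrete_generator \1_[set nat_level_state i] (nat_level_state j) *
    \1_[set nat_level_state j] w.
Proof.
under eq_bigr do rewrite mulrC.
rewrite sum_nat_level_state patchE -discrete_generator_level.
congr discrete_generator.
apply/funext => v; rewrite patchE; case: ifPn => // /negP vN.
rewrite indicE memNset// => /= vi; apply: vN; rewrite inE vi.
exact: nat_level_stateP.
Qed.

(** On the level the indicator acts as the constant 1, which the generator kills. *)
Lemma continuous_level_invariant (s t : R) z
    (p : R -> R.-pker (R * R)%type ~> (R * R)%type) :
  transition_function quadrant p ->
  has_generator quadrant p continuous_generator ->
  quadrant_level s z -> 0 <= t -> p t z (quadrant_level s) = 1%E.
Proof.
move=> tp gp zs t0.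
apply: (transition_function_invariant measurable_quadrant
  (measurable_quadrant_level s) _ tp gp) => // [w []//|w qw].
have -> : \1_(quadrant_level s) = (cst 1 : R * R -> R) \_ (quadrant_level s).
  by apply/funext => v; rewrite patchE indicE; case: ifP.
rewrite continuous_generator_level//; case: ifP => // _.
case: w {qw} => x y; rewrite /continuous_generator/= subrr /Rintegral.
by rewrite integral0_eq// => v _; rewrite integral0_eq.
Qed.

Lemma discrete_level_invariant (N : nat) (t : R) w
    (p : R -> R.-pker (nat * nat)%type ~> (nat * nat)%type) :
  transition_function setT p -> has_generator setT p discrete_generator ->
  nat_level N w -> 0 <= t -> p t w (nat_level N) = 1%E.
Proof.
move=> tp gp wN t0.
apply: (transition_function_invariant measurableT
  (measurable_nat_pair _) _ tp gp) => // v _.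
have -> : \1_(nat_level N) = (cst 1 : nat * nat -> R) \_ (nat_level N).
  by apply/funext => u; rewrite patchE indicE; case: ifP.
rewrite discrete_generator_level; case: ifP => // _.
case: v => n m; rewrite /discrete_generator big1// => k _; rewrite big1// => l _.
by rewrite subrr mulr0.
Qed.

End duality.

(** * From the pairing of flows to equality of expectations *)

Theorem theorem2p1 (R : realType)
  (d1 : measure_display) (Omega1 : measurableType d1)
  (P1 : probability Omega1 R) (XY : R -> Omega1 -> R * R)
  (d2 : measure_display) (Omega2 : measurableType d2)
  (P2 : probability Omega2 R) (NM : R -> Omega2 -> nat * nat)
  (x y : R) (n m : nat) (t : R)
  (hx : 0 <= x) (hy : 0 <= y) (ht : 0 < t)
  (hXY : markov_jump_process quadrant continuous_generator P1 XY (x, y))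
  (hNM : markov_jump_process [set: nat * nat] discrete_generator P2 NM (n, m)) :
  ('E_P1[fun w => duality_function n m (XY t w).1 (XY t w).2] =
   'E_P2[fun w => duality_function (NM t w).1 (NM t w).2 x y])%E.
Proof.
have [mXY _ _ XY0 [p [tp gp Mp]]] := hXY.
have [mNM _ _ NM0 [q [tq gq Mq]]] := hNM.
have t0 := ltW ht.
pose N := (n + m)%N; pose s := x + y; pose z := (x, y); pose w := (n, m).
have zs : quadrant_level s z by [].
have wN : nat_level N w by [].
have s0 : 0 <= s by rewrite addr_ge0.
pose D (v : nat * nat) (u : R * R) := duality_function v.1 v.2 u.1 u.2.
pose f (i : 'I_N.+1) : R * R -> R := D (nat_level_state i) \_ (quadrant_level s).
pose g (i : 'I_N.+1) : nat * nat -> R := \1_[set nat_level_state i].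
pose B (i j : 'I_N.+1) : R := discrete_generator (g j) (nat_level_state i).
(* [s ^+ N] bounds [D] on the levels and the added 1 bounds the indicators, so one constant serves
   both flows. *)
pose C := s ^+ N + 1.
have DC v u : nat_level N v -> quadrant_level s u -> `|D v u| <= C.
  move=> vN us; have [[u1 u2] _] := us.
  rewrite ger0_norm ?duality_function_ge0//.
  by rewrite (le_trans (duality_function_level_le _ _ us))// vN lerDl.
have C0 : 0 <= C by rewrite addr_ge0// exprn_ge0.
have DsC v u : nat_level N v -> `|(D v \_ (quadrant_level s)) u| <= C.
  move=> vN; rewrite patchE; case: ifPn; first by rewrite inE; exact: DC.
  by rewrite normr0.
have fC i u : `|f i u| <= C by apply: DsC; exact: nat_level_stateP.
have f0 i u : 0 <= f i u.
  rewrite /f patchE; case: ifPn => //; rewrite inE => -[[? ?] _].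
  exact: duality_function_ge0.
have mD v : measurable_fun setT (D v) by exact: measurable_duality_function.
have mf i : measurable_fun setT (f i).
  apply/(measurable_restrictT _ (measurable_quadrant_level s)).
  exact/measurable_funTS.
have gC i v : `|g i v| <= C.
  rewrite (@le_trans _ _ 1) ?lerDr ?exprn_ge0// /g indicE.
  by case: (_ \in _); rewrite ?normr1 ?normr0.
have mnat (h : nat * nat -> R) : measurable_fun setT h.
  by move=> _ A _; exact: measurable_nat_pair.
have fa : linear_flow B (fun r i => \int[p r z]_u f i u).
  apply: (semigroup_linear_flow (C := C) measurable_quadrant tp gp) => //.
  - by move=> i u qu; rewrite /f patchE memNset// => -[].
  - by move=> i u qu; exact: duality_generator_rates.
have fb : linear_flow (fun i j => B j i) (fun r i => \int[q r w]_v g i v).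
  apply: (semigroup_linear_flow (C := C) measurableT tq gq) => //.
  - by move=> i v [].
  - by move=> i v _; exact: indicator_generator_rates.
have aC r i : 0 <= r -> `|\int[p r z]_u f i u| <= C.
  by move=> _; exact: (semigroup_measurable p r (mf i) (f0 i) (fC i)).2.
have bC r i : 0 <= r -> `|\int[q r w]_v g i v| <= C.
  by move=> _; apply: (semigroup_measurable q r (mnat (g i)) _ (gC i)).2.
have := linear_flow_pairing aC bC fa fb t0.
(* At time 0 each integral is evaluation at the starting point; on the left, the indicators at [w]
   then keep only the term of [w] itself. *)
under eq_bigr do rewrite (transition_function0 tq)// mulrC.
under [RHS]eq_bigr do rewrite (transition_function0 tp)//.
rewrite (sum_nat_level_state N
  (fun v => \int[p t z]_u (D v \_ (quadrant_level s)) u)).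
rewrite patchE mem_set// => E.
have law1 A : measurable A -> P1 (XY t @^-1` A) = p t z A.
  exact: (markov_marginal (mXY 0 (lexx 0)) XY0 Mp t0).
have law2 A : measurable A -> P2 (NM t @^-1` A) = q t w A.
  exact: (markov_marginal (mNM 0 (lexx 0)) NM0 Mq t0).
(* Both expectations become integrals of [D] cut off to an invariant level, which has full mass at
   time [t]. *)
rewrite (expectation_on_full_set (F := D w) (C := C) (mXY t t0) law1
  (measurable_quadrant_level s))//; last 2 first.
- exact: (continuous_level_invariant tp gp).
- by move=> u; exact: DsC.
rewrite (expectation_on_full_set (F := D ^~ z) (C := C) (mNM t t0) law2
  (measurable_nat_pair (nat_level N)))//; last 2 first.
- exact: (discrete_level_invariant tq gq).
- move=> v; rewrite patchE; case: ifPn; last by rewrite normr0.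
  by rewrite inE => vN; exact: DC.
rewrite E; congr EFin.
have Ig i : (q t w).-integrable setT (EFin \o g i).
  exact: (bounded_probability_integrable (prob_kernel w) measurableT
    (mnat _) (gC i)).
(* Pulling the constants [f i z] and the sum inside leaves the integral of a combination of
   indicators, which is [D ^~ z] cut off to the level. *)
under eq_bigr => i _.
  rewrite mulrC -RintegralZr//; over.
rewrite -Rintegral_sum//; last first.
  move=> i.
  apply: (bounded_probability_integrable (C := C * C) (prob_kernel w)) => // v.
  by rewrite normrM ler_pM.
apply: eq_Rintegral => v _.
rewrite -(sum_nat_level_state N (D ^~ z)); apply: eq_bigr => i _.
by rewrite /f patchE mem_set.
Qed.
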